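(* The following assertions are equivalent. (1) $\mathfrak d=\omega_1$. (2) There is a system of fundamental sequences $\Lambda$ such that, for every compact $\mathcal K\subseteq\mathrm{FIN}^\star$, there is $\alpha<\omega_1$ with $\mathcal K\subseteq\mathcal S^\Lambda_\alpha$. (3) There is a system of fundamental sequences $\Lambda$ such that the family $(s^\Lambda_\alpha)_{\alpha<\omega_1}$ is $\leqslant^*$-cofinal in $(\mathbb N^\star)^{\mathbb N^\star}$. (4) There is a system of fundamental sequences $\Lambda$ such that, for every compact interval family $\mathcal K\subseteq\mathrm{FIN}^\star$, there is $\alpha<\omega_1$ for which $\mathcal K\setminus\mathcal S^\Lambda_\alpha$ is finite.
   Context: Let $\mathbb N^\star=\{2,3,\ldots\}$ and let $\mathrm{FIN}^\star=[\mathbb N^\star]^{<\omega}$ be the set of all finite subsets of $\mathbb N^\star$. Sets in $\mathrm{FIN}^\star$ are identified with their characteristic functions in the compact product space $2^{\mathbb N^\star}$; compactness of a subfamily of $\mathrm{FIN}^\star$ refers to the topology inherited from $2^{\mathbb N^\star}$. For non-empty $E,F\in\mathrm{FIN}^\star$, $E<F$ means $\max E<\min F$; for $d\in\mathbb N^\star$ and non-empty $A\in \mathrm{FIN}^\star$, $d\leqslant A$ means $d\leqslant\min A$. Let $\mathrm{Lim}(\omega_1)$ be the set of countable (non-zero) limit ordinals. A system of fundamental sequences is a family $\Lambda=(\lambda[n])_{\lambda\in\mathrm{Lim}(\omega_1),\,n\in\mathbb N^\star}$ of ordinals such that, for every $\lambda\in\mathrm{Lim}(\omega_1)$, $\lambda[2]<\lambda[3]<\cdots<\lambda=\sup_{n\in\mathbb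 N^\star}\lambda[n]$. Given $\Lambda$, the families $(\mathcal S^\Lambda_\alpha)_{\alpha<\omega_1}$ are defined recursively by $\mathcal S^\Lambda_0=\{\emptyset\}\cup\{\{n\}: n\in\mathbb N^\star\}$; $\mathcal S^\Lambda_{\alpha+1}=\mathcal S^\Lambda_\alpha\cup\{\bigcup_{i=1}^d A_i : 2\leqslant d\leqslant A_1<\cdots<A_d \text{ and } A_i\in\mathcal S^\Lambda_\alpha\setminus\{\emptyset\} \text{ for all } i\}$; and, for $\lambda\in\mathrm{Lim}(\omega_1)$, $\mathcal S^\Lambda_\lambda=\{\emptyset\}\cup\{A\in\mathrm{FIN}^\star\setminus\{\emptyset\} : \exists d\in\mathbb N^\star\ (d\leqslant A \text{ and } A\in\mathcal S^\Lambda_{\lambda[d]})\}$. For $n\leqslant k$ in $\mathbb N^\star$, $[n,k]=\{n,n+1,\ldots,k\}$; such sets are called intervals. An interval family is a family $\mathcal K\subseteq\mathrm{FIN}^\star$ whose non-empty members are intervals. For $\alpha<\omega_1$ and $n\in\mathbb N^\star$, $s^\Lambda_\alpha(n)=\max\{k\in\mathbb N^\star : n\leqslant k \text{ and } [n,k]\in\mathcal S^\Lambda_\alpha\}$ (this maximum exists). For $g,h:\mathbb N^\star\to\mathbb N^\star$, $g\leqslant^*h$ means $g(n)\leqslant h(n)$ for all but finitely many $n$. A family $\mathcal F\subseteq(\mathbb N^\star)^{\mathbb N^\star}$ is $\leqslant^*$-cofinal if every $g\in(\mathbb N^\star)^{\mathbb N^\star}$ satisfies $g\leqslant^* f$ for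 some $f\in\mathcal F$. The dominating number $\mathfrak d$ is the least cardinality of a $\leqslant^*$-cofinal family in $(\mathbb N^\star)^{\mathbb N^\star}$. *)

(* Defs.v *)
From HB Require Import structures.
From mathcomp Require Import all_boot all_order.
From mathcomp Require Import all_classical wochoice topology.

Set Implicit Arguments.
Unset Strict Implicit.
Unset Printing Implicit Defensive.

Import Order.TTheory.

Local Open Scope classical_set_scope.
Local Open Scope card_scope.

(* N* = {2, 3, ...} *)
Record Nstar : Type := MkNstar { nat_of_Nstar :> nat; _ : 1 < nat_of_Nstar }.

HB.instance Definition _ := [isSub for nat_of_Nstar].
HB.instance Definition _ := [Countable of Nstar by <:].

(* omega_1 is realised as the set of those points of a well-ordered uncountable
   set that have countably many predecessors.  The facts pinning it down up to
   isomorphism are omega1_lt_wf, countable_omega1_seg, uncountable_omega1. *)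
Definition wo_setN : rel (set nat) :=
  sval (well_ordering_principle (set nat)).

Definition wo_setN_seg (x : set nat) : set (set nat) :=
  [set y | wo_setN y x /\ y <> x].

Record omega1 : Type := MkOmega1 {
  omega1_point : set nat;
  _ : `[< countable (wo_setN_seg omega1_point) >] }.

HB.instance Definition _ := [isSub for omega1_point].
HB.instance Definition _ := [Choice of omega1 by <:].

Definition omega1_le (a b : omega1) : bool := wo_setN (\val a) (\val b).

Lemma wo_setN_min (A : set (set nat)) : A !=set0 ->
  exists2 z, A z & forall x, A x -> wo_setN z x.
Proof.
move=> [x Ax].
have [|z [[zA lbz] _]] :=
    svalP (well_ordering_principle (set nat)) (mem A).
  by exists x; rewrite inE.
by exists z => [|y Ay]; [rewrite inE in zA | apply: lbz; rewrite inE].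
Qed.

Lemma wo_setN_anti x y : wo_setN x y -> wo_setN y x -> x = y.
Proof.
move=> xy yx.
have wo := svalP (well_ordering_principle (set nat)).
have wo' : wo_chain wo_setN predT by move=> A _; exact: wo.
by apply: (wo_chain_antisymmetric wo') => //; apply/andP.
Qed.

Lemma wo_setN_total x y : wo_setN x y \/ wo_setN y x.
Proof.
have [|z zxy lb] := @wo_setN_min [set x; y]; first by exists x; left.
by case: zxy lb => -> lb; [left|right]; apply: lb; [right|left].
Qed.

Lemma wo_setN_refl x : wo_setN x x.
Proof. by case: (wo_setN_total x x). Qed.

Lemma wo_setN_trans y x z : wo_setN x y -> wo_setN y z -> wo_setN x z.
Proof.
move=> xy yz.
have [|t txyz lb] := @wo_setN_min [set x; y; z]; first by exists x; left; left.
have tx : wo_setN t x by apply: lb; left; left.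
have ty : wo_setN t y by apply: lb; left; right.
have tz : wo_setN t z by apply: lb; right.
case: txyz tx ty tz => [[|]|] -> tx ty tz //.
- by rewrite (wo_setN_anti xy tx).
- by rewrite (wo_setN_anti ty yz).
Qed.

Lemma omega1_le_refl : reflexive omega1_le.
Proof. by move=> a; exact: wo_setN_refl. Qed.

Lemma omega1_le_anti : antisymmetric omega1_le.
Proof. by move=> a b /andP[ab ba]; apply: val_inj; exact: wo_setN_anti. Qed.

Lemma omega1_le_trans : transitive omega1_le.
Proof. by move=> b a c; exact: wo_setN_trans. Qed.

Lemma omega1_le_total : total omega1_le.
Proof. by move=> a b; apply/orP; exact: wo_setN_total. Qed.

Fact omega1_display : Order.disp_t. Proof. exact: Order.Disp tt tt. Qed.

HB.instance Definition _ := Order.Le_isPOrder.Build omega1_display omega1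
  omega1_le_refl omega1_le_anti omega1_le_trans.
HB.instance Definition _ := Order.POrder_isTotal.Build omega1_display omega1
  omega1_le_total.

Lemma omega1_min (A : set omega1) : A !=set0 ->
  exists2 z, A z & forall x, A x -> (z <= x)%O.
Proof.
move=> [a Aa].
have [|z [b Ab <-] lb] := @wo_setN_min [set \val x | x in A].
  by exists (\val a), a.
by exists b => // x Ax; apply: lb; exists x.
Qed.

Lemma omega1_lt_wf : well_founded (fun a b : omega1 => (a < b)%O).
Proof.
move=> a; apply: contrapT => na.
have [|z nz lb] := @omega1_min [set x | ~ Acc (fun a b : omega1 => (a < b)%O) x].
  by exists a.
apply: nz; constructor => y yz; apply: contrapT => /lb.
by rewrite leNgt yz.
Qed.

Lemma countable_omega1_seg (a : omega1) : countable [set b : omega1 | (b < a)%O].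
Proof.
have /asboolP/countable_injP[f finj] := valP a.
apply/countable_injP; exists (f \o \val) => x y; rewrite !inE /= => xa ya fxy.
apply/val_inj/finj => //; rewrite inE; split.
- exact: (ltW xa).
- by move/val_inj => e; rewrite e ltxx in xa.
- exact: (ltW ya).
- by move/val_inj => e; rewrite e ltxx in ya.
Qed.

Lemma uncountable_omega1 : ~ countable [set: omega1].
Proof.
move=> /countable_injP[f finj].
pose C := [set x | countable (wo_setN_seg x)].
have Ccount : countable C.
  apply/countable_injP.
  exists (fun x => if insub x is Some a then f a else 0) => x y.
  rewrite !inE => Cx Cy.
  case: insubP => [u _ <-|]; last by rewrite asboolT.
  case: insubP => [v _ <-|]; last by rewrite asboolT.
  by move=> /finj ->; rewrite ?inE.
have [z nz lb] : exists2 z, ~ C z & forall x, ~ C x -> wo_setN z x.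
  apply: (@wo_setN_min (~` C)).
  apply: contrapT => /set0P/negP/negPn/eqP C0.
  have {}Ccount : countable [set: set nat] by rewrite -[setT](setCK) setCT -C0 setCK.
  have /countable_injP[g ginj] := Ccount.
  pose D := [set n | exists2 X, g X = n & ~ X n].
  have DgD : ~ D (g D).
    move=> /[dup] DgD [X /ginj e nX]; apply: nX.
    by rewrite e ?inE.
  by apply: (DgD); exists D.
apply: nz; rewrite /C /=.
apply: (sub_countable _ Ccount); apply: subset_card_le => x [xz xnz].
by apply: contrapT => /lb zx; apply: xnz; exact: wo_setN_anti.
Qed.

Definition is_zero (a : omega1) : Prop := forall b, (a <= b)%O.

Definition is_succ (a b : omega1) : Prop :=
  (a < b)%O /\ forall c, (a < c)%O -> (b <= c)%O.

Definition is_limit (l : omega1) : Prop :=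
  ~ is_zero l /\ ~ exists a, is_succ a l.

(* Only the values of L at limit ordinals matter. *)
Definition fundamental_system (L : omega1 -> Nstar -> omega1) : Prop :=
  forall l, is_limit l ->
    [/\ forall m n : Nstar, m < n -> (L l m < L l n)%O,
        forall n, (L l n < l)%O &
        supremums (range (L l)) l].

Definition is_min (A : set Nstar) (m : Nstar) : Prop :=
  A m /\ forall x, A x -> m <= x.

Definition is_max (A : set Nstar) (m : Nstar) : Prop :=
  A m /\ forall x, A x -> x <= m.

Definition FIN : set (set Nstar) := [set A | finite_set A].

(* E < F and d <= A; both entail that the sets involved are non-empty. *)
Definition set_lt (E F : set Nstar) : Prop :=
  exists m n : Nstar, [/\ is_max E m, is_min F n & m < n].

Definition le_set (d : Nstar) (A : set Nstar) : Prop :=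
  exists m : Nstar, is_min A m /\ d <= m.

(* The transfinite recursion defining the families S_a, written as an inductive
   predicate (for a fundamental system L every clause refers to smaller ordinals
   only); its defining equations are schreier0E, schreierSE, schreier_limE. *)
Inductive schreier (L : omega1 -> Nstar -> omega1) :
    omega1 -> set Nstar -> Prop :=
| schreier_zero_set0 a : is_zero a -> schreier L a set0
| schreier_zero_set1 a n : is_zero a -> schreier L a [set n]
| schreier_succ_sub a b A : is_succ a b -> schreier L a A -> schreier L b A
| schreier_succ_bigcup a b (d : Nstar) (A : nat -> set Nstar) :
    is_succ a b ->
    le_set d (A 1) ->
    (forall i, 1 <= i < d -> set_lt (A i) (A i.+1)) ->
    (forall i, 1 <= i <= d -> schreier L a (A i) /\ A i !=set0) ->
    schreier L b (\bigcup_(i in [set i | 1 <= i <= d]) A i)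
| schreier_limit_set0 l : is_limit l -> schreier L l set0
| schreier_limit_le l (d : Nstar) A :
    is_limit l -> FIN A -> A !=set0 -> le_set d A -> schreier L (L l d) A ->
    schreier L l A.

Lemma is_succ_inj a a' b : is_succ a b -> is_succ a' b -> a = a'.
Proof.
move=> [ab abP] [a'b a'bP]; apply/eqP; rewrite eq_le !leNgt; apply/andP; split.
  by apply/negP => /a'bP; rewrite leNgt ab.
by apply/negP => /abP; rewrite leNgt a'b.
Qed.

Lemma is_succN0 a b : is_succ a b -> ~ is_zero b.
Proof. by move=> [ab _] /(_ a); rewrite leNgt ab. Qed.

Lemma schreierP L a A : schreier L a A ->
  [\/ is_zero a /\ (A = set0 \/ exists n, A = [set n]),
   exists2 b, is_succ b a & schreier L b A \/
     exists (d : Nstar) (B : nat -> set Nstar),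
     [/\ le_set d (B 1), forall i, 1 <= i < d -> set_lt (B i) (B i.+1),
         forall i, 1 <= i <= d -> schreier L b (B i) /\ B i !=set0 &
         A = \bigcup_(i in [set i | 1 <= i <= d]) B i] |
   is_limit a /\ (A = set0 \/
     [/\ FIN A, A !=set0 & exists2 d, le_set d A & schreier L (L a d) A])].
Proof.
case=> {A} [{}a a0|{}a n a0|b {}a A ba bA|b {}a d B ba dB BB Bb|l l0|l d A l0 fA A0 dA lA].
- by constructor 1; split=> //; left.
- by constructor 1; split=> //; right; exists n.
- by constructor 2; exists b => //; left.
- by constructor 2; exists b => //; right; exists d, B.
- by constructor 3; split=> //; left.
- by constructor 3; split=> //; right; split=> //; exists d.
Qed.

Lemma schreier0E L a : is_zero a ->
  schreier L a = [set set0] `|` [set [set n] | n in setT].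
Proof.
move=> a0; apply/seteqP; split => [A /schreierP|A [->|[n _ <-]]].
- case=> [[_ [->|[n ->]]]|[b /is_succN0//]|[[]//]]; first by left.
  by right; exists n.
- exact: schreier_zero_set0.
- exact: schreier_zero_set1.
Qed.

Lemma schreierSE L a b : is_succ a b ->
  schreier L b = schreier L a `|`
    [set A | exists (d : Nstar) (B : nat -> set Nstar),
      [/\ le_set d (B 1), forall i, 1 <= i < d -> set_lt (B i) (B i.+1),
          forall i, 1 <= i <= d -> schreier L a (B i) /\ B i !=set0 &
          A = \bigcup_(i in [set i | 1 <= i <= d]) B i]].
Proof.
move=> ab; apply/seteqP; split => [A /schreierP|A [|]].
- case=> [[/(is_succN0 ab)//]|[c /is_succ_inj -/(_ _ ab)-> //]|[[_]]].
  by case; exists a.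
- exact: schreier_succ_sub.
- by move=> [d [B [? ? ? ->]]]; exact: schreier_succ_bigcup ab _ _ _.
Qed.

Lemma schreier_limE L l : is_limit l ->
  schreier L l = [set set0] `|`
    [set A | [/\ FIN A, A !=set0 & exists2 d, le_set d A & schreier L (L l d) A]].
Proof.
move=> ll; apply/seteqP; split => [A /schreierP|A [->|]].
- by case: (ll) => l0 lS [[//]|[b bl _]|[_ []]];
    [case: lS; exists b | left | right].
- exact: schreier_limit_set0.
- by move=> [? ? [d ? ?]]; exact: (schreier_limit_le (d := d)).
Qed.

Definition interval (n k : Nstar) : set Nstar := [set x : Nstar | n <= x <= k].

Definition interval_family (K : set (set Nstar)) : Prop :=
  K `<=` FIN /\
  forall A, K A -> A !=set0 -> exists n k : Nstar, n <= k /\ A = interval n k.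

(* The default value n of xget is irrelevant, since the maximum exists for a
   fundamental system L: schreier_maxP. *)
Definition schreier_max (L : omega1 -> Nstar -> omega1) (a : omega1)
    (n : Nstar) : Nstar :=
  xget n (is_max [set k : Nstar | n <= k /\ schreier L a (interval n k)]).

Lemma interval_min (n k : Nstar) : n <= k -> is_min (interval n k) n.
Proof. by move=> nk; split=> [|x /andP[]//]; rewrite /interval/= leqnn. Qed.

Lemma is_min_unique A m n : is_min A m -> is_min A n -> m = n.
Proof.
move=> [Am mP] [An nP]; apply/val_inj/eqP.
by rewrite eqn_leq (mP _ An) (nP _ Am).
Qed.

Lemma schreier_set1 L a n : fundamental_system L -> schreier L a [set n].
Proof.
move=> fL; elim/(well_founded_ind omega1_lt_wf): a => a IH.
have [a0|na0] := pselect (is_zero a); first exact: schreier_zero_set1.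
have [[b ba]|nS] := pselect (exists b, is_succ b a).
  by apply: (schreier_succ_sub ba); apply: IH; case: ba.
have la : is_limit a by [].
apply: (schreier_limit_le (d := n) la); first exact: finite_set1.
- by exists n.
- by exists n; split=> //; split=> // x ->.
- by apply: IH; case: (fL _ la).
Qed.

Lemma schreier_bounded L a : fundamental_system L -> forall n : Nstar,
  exists b : nat, forall k : Nstar, n <= k -> schreier L a (interval n k) -> k <= b.
Proof.
move=> fL; elim/(well_founded_ind omega1_lt_wf): a => a IH n.
have nP (k : Nstar) : n <= k -> ~ (interval n k = set0).
  by move=> nk /seteqP[/(_ n) + _]; apply; rewrite /interval/= leqnn.
have [a0|na0] := pselect (is_zero a).
  exists n => k nk; rewrite (schreier0E L a0) => -[/(nP _ nk)//|[m _ e]].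
  have : [set m] k by rewrite e /interval/= nk leqnn.
  have : [set m] n by rewrite e /interval/= nk leqnn.
  by move=> -> ->.
have [[b ba]|nS] := pselect (exists b, is_succ b a); last first.
  have la : is_limit a by [].
  have [f fP] : exists f : Nstar -> nat, forall d k : Nstar, n <= k ->
      schreier L (L a d) (interval n k) -> k <= f d.
    suff /choice[f fP] : forall d, exists c, forall k : Nstar, n <= k ->
        schreier L (L a d) (interval n k) -> k <= c by exists f.
    by move=> d; apply: IH; case: (fL _ la).
  exists (\max_(i < n.+1) if insub (i : nat) is Some d then f d else 0).
  move=> k nk; rewrite (schreier_limE L la) => -[/(nP _ nk)//|[_ _ [d dA]]].
  move=> /(fP _ _ nk) /leq_trans; apply.
  have dn : d < n.+1.
    by case: dA => m [/is_min_unique -/(_ _ (interval_min nk)) ->].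
  have -> : f d = (if insub (Ordinal dn : nat) is Some d then f d else 0).
    by rewrite /= valK.
  exact: leq_bigmax.
have [f fP] : exists f : Nstar -> nat, forall m k : Nstar, m <= k ->
    schreier L b (interval m k) -> k <= f m.
  suff /choice[f fP] : forall m : Nstar, exists c, forall k : Nstar, m <= k ->
      schreier L b (interval m k) -> k <= c by exists f.
  by move=> m; apply: IH; case: ba.
pose B m := \max_(i < m.+1) if insub (i : nat) is Some d then f d else 0.
have BP (m : Nstar) x : m <= x -> f m <= B x.
  move=> mx; have -> : f m = (if insub (Ordinal (mx : m < x.+1) : nat) is Some d then f d else 0).
    by rewrite /= valK.
  exact: leq_bigmax.
pose c i := iter i (fun x => maxn x (B x.+1)) (n : nat).
have cS i : c i.+1 = maxn (c i) (B (c i).+1) by [].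
have cle i j : i <= j -> c i <= c j.
  by apply: (homo_leq leqnn (fun _ _ _ => @leq_trans _ _ _)) => {}i; rewrite cS leq_maxl.
exists (maxn (f n) (c n)) => k nk.
rewrite (schreierSE L ba) => -[/(fP _ _ nk) h|[d [A [dA AA Ab nkE]]]].
  by rewrite leq_max h.
have d1 : 1 < d := valP d.
have ltA i j x y : 1 <= i -> i < j -> j <= d -> A i x -> A j y -> (x : Nstar) < (y : Nstar).
  move=> i1; elim: j y => // j IHj y; rewrite ltnS leq_eqVlt => /orP[/eqP<-|ij] jd Ax Ay.
    have [|m [m' [[_ mP] [_ m'P] mm']]] := AA i; first by rewrite i1.
    exact: leq_ltn_trans (mP _ Ax) (leq_trans mm' (m'P _ Ay)).
  have [|m [m' [[Am mP] [_ m'P] mm']]] := AA j; first by rewrite jd (leq_trans i1 (ltnW ij)).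
  have xm : x < m := IHj _ ij (ltnW jd) Ax Am.
  exact: ltn_trans xm (leq_trans mm' (m'P _ Ay)).
have Ank i x : 1 <= i <= d -> A i x -> n <= x <= k.
  by move=> id Ax; have : interval n k x by rewrite nkE; exists i.
have nkA (x : Nstar) : n <= x <= k -> exists2 i, 1 <= i <= d & A i x.
  by move=> xnk; have : interval n k x by []; rewrite nkE => -[i]; exists i.
have dn : d <= n.
  case: dA => m [[A1m mP] dm].
  have [|i /andP[i1 id] Ain] := nkA n; first by rewrite leqnn.
  move: i1; rewrite leq_eqVlt => /orP[/eqP i1|i1].
    by rewrite -i1 in Ain; exact: leq_trans dm (mP _ Ain).
  have := ltA 1 i _ _ isT i1 id A1m Ain.
  by rewrite ltnNge; have /andP[-> _] := Ank 1 m (ltnW d1) A1m.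
have minmax i : 1 <= i <= d -> exists m M : Nstar, is_min (A i) m /\ is_max (A i) M.
  move=> /andP[i1 id]; move: id; rewrite leq_eqVlt => /orP[/eqP id|id].
    have [|m [m' [_ h _]]] := AA i.-1.
      by rewrite id; case: (nat_of_Nstar d) d1 => [|[|e]] //= _; rewrite leqnn.
    rewrite prednK// in h; exists m', k; split=> //; split=> [|x Ax]; last first.
      by have /andP[] : n <= x <= k by apply: (Ank i) => //; rewrite i1 id leqnn.
    have [|j /andP[j1 jd] Ajk] := nkA k; first by rewrite nk leqnn.
    move: jd; rewrite leq_eqVlt => /orP[/eqP jd|jd]; first by rewrite id -jd.
    rewrite -id in jd; have := ltA j i _ _ j1 jd (eq_leq id) Ajk h.1.
    rewrite ltnNge; have /andP[_ ->//] : n <= m' <= k by apply: (Ank i _ _ h.1); rewrite i1 id leqnn.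
  have [|M [_ [h _ _]]] := AA i; first by rewrite i1.
  move: i1; rewrite leq_eqVlt => /orP[/eqP i1|i1].
    by case: dA => m [hm _]; exists m, M; rewrite -i1 in h *.
  have [|_ [m [_ h' _]]] := AA i.-1; first by rewrite -ltnS prednK ?i1 ?(ltnW id) // ltnW.
  by exists m, M; rewrite prednK ?(ltnW i1) // in h'.
have Ac i : 1 <= i <= d -> forall x, A i x -> x <= c i.
  elim: i => // i IHi id x Aix.
  have [m [M [[Am mP] [AM MP]]]] := minmax _ id.
  have lec j y : 1 <= j <= i -> A j y -> y <= c i.
    move=> /andP[j1 ji] Ay.
    have i1 : 1 <= i by exact: leq_trans ji.
    have id' : 1 <= i <= d by rewrite i1 /= ltnW //; case/andP: id.
    move: ji; rewrite leq_eqVlt => /orP[/eqP e|ji]; first by apply: IHi => //; rewrite -e.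
    have [m0 [M0 [[Am0 _] _]]] := minmax _ id'.
    apply: ltnW; apply: leq_trans (IHi id' _ Am0).
    by apply: (ltA j i _ _ j1 ji) => //; case/andP: id'.
  have mc : m <= (c i).+1.
    rewrite leqNgt; apply/negP => cm.
    have c1 : 1 < (c i).+1.
      by rewrite ltnS; apply: leq_trans (cle 0 i (leq0n _)); exact: ltnW (valP n).
    pose z : Nstar := MkNstar c1.
    have /andP[nm mk] := Ank _ _ id Am.
    have [|j /andP[j1 jd] Az] := nkA z.
      apply/andP; split.
        exact: leq_trans (cle 0 i (leq0n _)) (leqnSn _).
      exact: leq_trans (ltnW cm) mk.
    have [ji|ij] := leqP j i.
      by have := lec j z _ Az; rewrite j1 ji /= ltnn => /(_ isT).
    move: ij; rewrite leq_eqVlt => /orP[/eqP e|ij].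
      by rewrite -e in Az; have := mP _ Az; rewrite leqNgt /= cm.
    have := ltA i.+1 j _ _ isT ij jd Am Az.
    by rewrite ltnNge /= (ltnW cm).
  have e : A i.+1 = interval m M.
    apply/seteqP; split => y /=; first by move=> Ay; rewrite /interval /= mP // MP.
    move=> /andP[my yM].
    have [|j /andP[j1 jd] Ay] := nkA y.
      have /andP[nm _] := Ank _ _ id Am; have /andP[_ Mk] := Ank _ _ id AM.
      by rewrite (leq_trans nm my) (leq_trans yM Mk).
    have [ji|ij|<-//] := ltngtP j i.+1.
      have := ltA j i.+1 _ _ j1 ji _ Ay Am; case/andP: id => _ -> /(_ isT).
      by rewrite ltnNge my.
    have := ltA i.+1 j _ _ isT ij jd AM Ay.
    by rewrite ltnNge yM.
  have [+ _] := Ab _ id; rewrite e => /(fP _ _ (mP _ AM)) Mf.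
  rewrite cS leq_max; apply/orP; right.
  exact: leq_trans (MP _ Aix) (leq_trans Mf (BP _ _ mc)).
rewrite leq_max; apply/orP; right.
have [|i /andP[i1 id] Ak] := nkA k; first by rewrite nk leqnn.
apply: leq_trans (cle _ _ (leq_trans id dn)).
by apply: Ac => //; rewrite i1.
Qed.

Lemma schreier_maxP L a (n : Nstar) : fundamental_system L ->
  is_max [set k : Nstar | n <= k /\ schreier L a (interval n k)]
    (schreier_max L a n).
Proof.
move=> fL; apply: xgetPex; set S := [set k : Nstar | _].
have [b bP] := schreier_bounded a fL n.
have S0 : exists i, `[< exists2 k : Nstar, S k & k = i :> nat >].
  exists n; apply/asboolP; exists n => //; split=> //.
  have -> : interval n n = [set n].
    apply/seteqP; split=> x; rewrite /interval /= -eqn_leq; last by move->.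
    by move/eqP => e; apply/val_inj.
  exact: schreier_set1 fL.
have Sb i : `[< exists2 k : Nstar, S k & k = i :> nat >] -> i <= b.
  by move=> /asboolP[k [nk Sk] <-]; exact: bP.
case: (ex_maxnP S0 Sb) => i /asboolP[k Sk <-] kP.
by exists k; split=> // x Sx; apply: kP; apply/asboolP; exists x.
Qed.

Definition charfun (A : set Nstar) : prod_topology (fun _ : Nstar => bool) :=
  fun n => n \in A.

(* Compactness is intrinsic, so compactness for the inherited topology is
   compactness as a subset of the product space. *)
Definition compact_family (K : set (set Nstar)) : Prop :=
  compact (charfun @` K).

Definition le_star (g h : Nstar -> Nstar) : Prop :=
  finite_set [set n | ~ (g n <= h n)].

Definition le_star_cofinal (F : set (Nstar -> Nstar)) : Prop :=
  forall g, exists2 f, F f & le_star g f.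

(* The least cardinality of a cofinal family is that of the set K. *)
Definition is_dominating_number (T : Type) (K : set T) : Prop :=
  (exists2 F, le_star_cofinal F & F #= K) /\
  forall F, le_star_cofinal F -> K #<= F.

(* Main.v *)
(** Only (1) => (2) needs a construction.  For any fundamental system, a < b
    gives an m such that every member of S_a with minimum at least m lies in
    S_b; as at most m elements lie below m and each can be prepended as a
    singleton block at the cost of one successor, S_a is contained in S_(b+m).
    Hence finitely many families of index below a limit l are all contained in
    a single S_c with c < l.  If the dominating number is omega_1, there are
    finite sets w(l, n) of ordinals such that, for every sequence b of countable
    ordinals and every large l, b(n) lies in w(l, n) for almost all n.  Choose
    l[n] recursively so that S_(l[n]) contains S_c for all c < l in w(l, n).
    Then for every b some S_a contains, for all n, the members of S_(b(n)) with
    minimum n.  A compact family contained in no S_a would then, by fixing the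
    elements of its members one after the other, have an infinite limit point.
    The other implications use the compact interval families
    {0} U {[n, max(n, g n)] : n}, and the uncountability of cofinal families. *)

Require Import Defs.
From mathcomp Require Import all_boot all_order.
From mathcomp Require Import all_classical topology.

Set Implicit Arguments.
Unset Strict Implicit.
Unset Printing Implicit Defensive.

Import Order.TTheory.

Local Open Scope classical_set_scope.
Local Open Scope card_scope.

(** * Subsets of N* *)

Lemma finite_set_bounded (T : choiceType) (A : set T) (m : T -> nat) :
  finite_set A -> exists M, forall x, A x -> m x <= M.
Proof.
move=> /finite_seqP[s ->]; exists (\max_(i <- s) m i) => x /= xs.
exact: leq_bigmax_seq.
Qed.

Lemma finite_Nstar_le (m : nat) : finite_set [set n : Nstar | n <= m].
Proof.
have -> : [set n : Nstar | n <= m] = nat_of_Nstar @^-1` `I_m.+1 by [].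
by apply: finite_preimage (finite_II _) => x y _ _; exact: val_inj.
Qed.

Lemma set_Nstar_min (A : set Nstar) : A !=set0 -> exists m, is_min A m.
Proof.
move=> [x Ax].
have A0 : exists i, `[< exists2 k : Nstar, A k & k = i :> nat >].
  by exists x; apply/asboolP; exists x.
case: (ex_minnP A0) => i /asboolP[k Ak <-] kP.
by exists k; split=> // y Ay; apply: kP; apply/asboolP; exists y.
Qed.

Lemma set_Nstar_max (A : set Nstar) :
  finite_set A -> A !=set0 -> exists m, is_max A m.
Proof.
move=> /(finite_set_bounded nat_of_Nstar)[M AM] [x Ax].
have A0 : exists i, `[< exists2 k : Nstar, A k & k = i :> nat >].
  by exists x; apply/asboolP; exists x.
have Ab i : `[< exists2 k : Nstar, A k & k = i :> nat >] -> i <= M.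
  by move=> /asboolP[k Ak <-]; exact: AM.
case: (ex_maxnP A0 Ab) => i /asboolP[k Ak <-] kP.
by exists k; split=> // y Ay; apply: kP; apply/asboolP; exists y.
Qed.

Lemma le_setI (d : Nstar) (A : set Nstar) :
  A !=set0 -> (forall x, A x -> d <= x) -> le_set d A.
Proof.
move=> /set_Nstar_min[m mA] dA; exists m; split=> //.
by apply: dA; case: mA.
Qed.

Lemma le_set_le (d : Nstar) (A : set Nstar) x : le_set d A -> A x -> d <= x.
Proof. by move=> [m [[_ mA] dm]] /mA; exact: leq_trans. Qed.

Lemma set_ltI (A B : set Nstar) : finite_set A -> A !=set0 -> B !=set0 ->
  (forall x y : Nstar, A x -> B y -> x < y) -> set_lt A B.
Proof.
move=> fA A0 /set_Nstar_min[n nB] AB; have [m mA] := set_Nstar_max fA A0.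
by exists m, n; split=> //; apply: AB; [case: mA | case: nB].
Qed.

Lemma set_lt_lt (A B : set Nstar) (x y : Nstar) :
  set_lt A B -> A x -> B y -> x < y.
Proof.
by move=> [m [n [[_ mA] [_ nB] mn]]] /mA xm /nB; apply: leq_trans;
  exact: leq_ltn_trans xm mn.
Qed.

(** * Countable ordinals *)

(** Regularity of omega_1: without a strict bound it would be a countable union of the segments
    below the [b i] and the points [b i]. For the empty family the bound merely supplies an element
    of [omega1]. *)
Lemma omega1_seq_bounded (I : countType) (b : I -> omega1) :
  exists c, forall i, (b i < c)%O.
Proof.
apply: contrapT => nb; apply: uncountable_omega1.
have -> : [set: omega1] = \bigcup_(p in [set: I * bool])
    if p.2 then [set x | (x < b p.1)%O] else [set b p.1].
  apply/esym/seteqP; split=> // c _; apply: contrapT => nc; apply: nb.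
  exists c => i; rewrite ltNge le_eqVlt; apply/negP => cb; apply: nc.
  by case/orP: cb => [/eqP ->|cb]; [exists (i, false)|exists (i, true)].
apply: bigcup_countable => [|[i []] _ /=]; first exact: countableP.
  exact: countable_omega1_seg.
exact: countable1.
Qed.

Lemma ex_succ a : exists b, is_succ a b.
Proof.
have [c ac] := omega1_seq_bounded (fun _ : unit => a).
have [|b ab bP] := @omega1_min [set x | (a < x)%O]; first by exists c; exact: ac tt.
by exists b.
Qed.

Definition osucc a : omega1 := sval (cid (ex_succ a)).

Lemma osuccP a : is_succ a (osucc a).
Proof. by rewrite /osucc; case: cid. Qed.

Lemma lt_osucc a : (a < osucc a)%O.
Proof. by have [] := osuccP a. Qed.

Lemma le_iter_osucc k a : (a <= iter k osucc a)%O.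
Proof. by elim: k => //= k /le_trans; apply; exact/ltW/lt_osucc. Qed.

Lemma limit_osucc l a : is_limit l -> (a < l)%O -> (osucc a < l)%O.
Proof.
move=> [_ lS] al; rewrite lt_neqAle (osuccP a).2 // andbT.
by apply/eqP => e; apply: lS; exists a; rewrite -e; exact: osuccP.
Qed.

Lemma limit_iter_osucc l k a : is_limit l -> (a < l)%O -> (iter k osucc a < l)%O.
Proof. by move=> ll al; elim: k => //= k; exact: limit_osucc. Qed.

Lemma omega1_cases a : [\/ is_zero a, exists b, is_succ b a | is_limit a].
Proof.
have [a0|na0] := pselect (is_zero a); first by constructor 1.
by have [aS|naS] := pselect (exists b, is_succ b a); [constructor 2|constructor 3].
Qed.

Lemma is_succ_le a b c : is_succ b a -> (c < a)%O -> (c <= b)%O.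
Proof.
move=> [_ ab] ca; rewrite leNgt; apply/negP => /ab.
by rewrite leNgt ca.
Qed.

(** The least ordinal above all [iter k osucc a] is a limit, since an immediate predecessor would
    already lie above all of them. *)
Lemma limit_above a : exists2 l, is_limit l & (a < l)%O.
Proof.
have [c cP] := omega1_seq_bounded (fun k => iter k osucc a).
have [|l lP lmin] := @omega1_min [set x | forall k, (iter k osucc a < x)%O].
  by exists c.
exists l; last exact: (lP 0).
split=> [/(_ a)|[p pl]]; first by rewrite leNgt (lP 0).
have /lmin : [set x | forall k, (iter k osucc a < x)%O] p.
  move=> k; apply: lt_le_trans (is_succ_le pl (lP k.+1)).
  exact: lt_osucc.
by rewrite leNgt pl.1.
Qed.

Lemma omega1_seg_enum a :
  exists e : nat -> omega1, forall b, (b < a)%O -> exists i, e i = b.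
Proof.
have /countable_injP[f finj] := countable_omega1_seg a.
exists (fun i => xget a [set b | (b < a)%O /\ f b = i]) => b ba.
exists (f b); set S := [set c | _].
have [|ca fcb] := @xgetPex _ a S; first by exists b.
by apply: finj; rewrite ?inE.
Qed.

(** Transfinite recursion with a relational step. Choice turns [R] into a function; partial
    functions are padded with [t0], which the locality hypothesis renders harmless. *)
Lemma omega1_rec (T : Type) (R : omega1 -> (omega1 -> T) -> T -> Prop) :
  inhabited T ->
  (forall a f, exists t, R a f t) ->
  (forall (a : omega1) f g t, (forall b : omega1, (b < a)%O -> f b = g b) -> R a f t -> R a g t) ->
  exists f, forall a, R a f (f a).
Proof.
move=> [t0] Rex Rloc.
have [H HP] : exists H : omega1 * (omega1 -> T) -> T, forall p, R p.1 p.2 (H p).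
  suff /choice[H HP] : forall p : omega1 * (omega1 -> T), exists t, R p.1 p.2 t.
    by exists H.
  by case=> a f; exact: Rex.
pose ext (a : omega1) (g : forall b : omega1, (b < a)%O -> T) (b : omega1) :=
  if pselect (b < a)%O is left ba then g b ba else t0.
pose f := Fix omega1_lt_wf (fun=> T) (fun a g => H (a, ext a g)).
exists f => a.
have -> : f a = H (a, ext a (fun b _ => f b)).
  apply: Fix_eq => {}a g h gh; congr (H (a, _)).
  by apply/funext => b; rewrite /ext; case: pselect.
apply: (Rloc _ _ _ _ _ (HP (a, _))) => b ba /=.
by rewrite /ext; case: pselect.
Qed.

(** * Schreier families *)

Section Schreier.
Variables (L : omega1 -> Nstar -> omega1) (fL : fundamental_system L).

Lemma schreier_FIN a A : schreier L a A -> finite_set A.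
Proof.
elim/(well_founded_ind omega1_lt_wf): a A => a IH A.
case/schreierP => [[_ [->|[n ->]]]|[b ba [bA|[d [B [_ _ BS ->]]]]]|[_ [->|[]//]]].
- exact: finite_set0.
- exact: finite_set1.
- by apply: (IH b) => //; case: ba.
- apply: bigcup_finite => [|i /BS[Bb _]]; last by apply: (IH b) => //; case: ba.
  by apply: sub_finite_set (finite_II d.+1) => i /andP[].
- exact: finite_set0.
Qed.

Lemma schreier_set0 a : schreier L a set0.
Proof.
elim/(well_founded_ind omega1_lt_wf): a => a IH.
have [a0|[b ba]|la] := omega1_cases a.
- exact: schreier_zero_set0.
- by apply: (schreier_succ_sub ba); apply: IH; case: ba.
- exact: schreier_limit_set0.
Qed.

(* Unions of at most [k] consecutive members of [S_a]; allowing the empty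
   member spares all reindexing. *)
Fixpoint schreier_chain a k (A : set Nstar) : Prop :=
  if k is k'.+1 then exists B C, [/\ A = B `|` C, schreier L a B,
    schreier_chain a k' C & forall x y : Nstar, B x -> C y -> x < y]
  else A = set0.

(** Dropping the empty members of a chain leaves the numbered non-empty blocks of the successor
    clause, possibly fewer than [k]. *)
Lemma schreier_chain_pieces a k A : schreier_chain a k A ->
  exists e (B : nat -> set Nstar), [/\ e <= k,
    forall i, 1 <= i <= e -> schreier L a (B i) /\ B i !=set0,
    forall i j (x y : Nstar), 1 <= i -> i < j -> j <= e -> B i x -> B j y -> x < y &
    A = \bigcup_(i in [set i | 1 <= i <= e]) B i].
Proof.
elim: k A => [A ->|k IH A [B [C [-> aB /IH[e [D [ek aD ltD ->]]] BC]]]].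
  exists 0, (fun=> set0); split=> //; first by case.
  by apply/seteqP; split=> // x [[]].
have [B0|nB0] := pselect (B !=set0); last first.
  exists e, D; split=> //; first exact: leqW.
  rewrite (_ : B = set0) ?set0U //; apply/seteqP; split=> // x Bx.
  by case: nB0; exists x.
exists e.+1, (fun i => if i == 1 then B else D i.-1); split=> //.
- by move=> [|[|i]] //= ie; apply: aD.
- move=> [|[|i]] [|[|j]] //= x y _ ij je Bx Dy.
    by apply: BC => //; exists j.+1.
  exact: (ltD i.+1 j.+1).
- apply/seteqP; split=> x.
    case=> [Bx|[i /= ie Dx]]; first by exists 1.
    by exists i.+1; case: i ie Dx.
  by case=> [[|[|i]]] //= ie Dx; [left|right; exists i.+1].
Qed.

(** The successor clause in a form stable under subsets: blocks may be empty, and [d] only bounds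
    their number. *)
Lemma schreier_succP a b A : is_succ a b ->
  schreier L b A <-> schreier L a A \/
    exists d : Nstar, (forall x, A x -> d <= x) /\ schreier_chain a d A.
Proof.
move=> ab; split=> [|[|[d [dA /schreier_chain_pieces]]]].
- rewrite (schreierSE L ab) => -[|[d [B [dB BB Ba ->]]]]; first by left.
  right; exists d.
  have ltB i j (x y : Nstar) : 1 <= i -> i < j -> j <= d -> B i x -> B j y -> x < y.
    move=> i1; elim: j y => // j IHj y; rewrite ltnS leq_eqVlt => /orP[/eqP<-|ij] jd Bx By.
      by apply: (set_lt_lt _ Bx By); apply: BB; rewrite i1.
    have j1 : 1 <= j by exact: leq_trans (ltnW ij).
    have [|_ [z Bz]] := Ba j; first by rewrite j1 ltnW.
    apply: ltn_trans (IHj z ij (ltnW jd) Bx Bz) _.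
    by apply: (set_lt_lt _ Bz By); apply: BB; rewrite j1.
  split=> [x [[|[|i]] //= id Bx]|]; first exact: le_set_le dB Bx.
    have [|_ [z Bz]] := Ba 1; first exact: leq_trans id.
    exact: leq_trans (le_set_le dB Bz) (ltnW (ltB 1 i.+2 z x isT isT id Bz Bx)).
  suff chain k j : 1 <= j -> j + k = d.+1 ->
      schreier_chain a k (\bigcup_(i in [set i | j <= i <= d]) B i) by exact: chain.
  elim: k j => [|k IH] j j1 jk /=.
    apply/seteqP; split=> // x [i /= /andP[ji]].
    by rewrite leqNgt -ltnS ltnNge -{1}jk addn0 ltnNge ji.
  have jd : j <= d by rewrite -ltnS -jk addnS ltnS leq_addr.
  exists (B j), (\bigcup_(i in [set i | j.+1 <= i <= d]) B i); split.
  + apply/seteqP; split=> x.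
      case=> i /= /andP[]; rewrite leq_eqVlt => /orP[/eqP<-|ji id] Bx; first by left.
      by right; exists i => //=; rewrite ji.
    case=> [Bx|[i /= /andP[ji id] Bx]]; first by exists j => //=; rewrite leqnn.
    by exists i => //=; rewrite id ltnW.
  + by have [|] := Ba j; rewrite ?j1.
  + by apply: IH; rewrite // addSnnS.
  + by move=> x y Bx [i /= /andP[ji id] By]; exact: (ltB j i).
- exact: schreier_succ_sub.
(* With at most one non-empty block [A] is already in the smaller family; otherwise the number of
   non-empty blocks is itself the required [d]. *)
- move=> [e [B [ed aB ltB AE]]]; case: e => [|[|e]] in ed aB ltB AE *.
  + rewrite AE; rewrite (_ : \bigcup_(_ in _) _ = set0); first exact: schreier_set0.
    by apply/seteqP; split=> // x [[|i]].
  + apply: (schreier_succ_sub ab); rewrite AE.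
    rewrite (_ : [set i | _] = [set 1]); last first.
      apply/seteqP; split=> i /=; last by move->.
      by rewrite -eqn_leq => /eqP.
    by rewrite bigcup_set1; case: (aB 1).
  + have e1 : 1 < e.+2 by [].
    rewrite AE; apply: (schreier_succ_bigcup (d := MkNstar e1) ab) => //.
    * apply: le_setI => [|x Bx]; first by case: (aB 1).
      apply: leq_trans ed (dA _ _); rewrite AE; by exists 1.
    * move=> i /andP[i1 ie].
      have [Bi Bi0] : schreier L a (B i) /\ B i !=set0 by apply: aB; rewrite i1 ltnW.
      have [_ BS0] : schreier L a (B i.+1) /\ B i.+1 !=set0 by apply: aB.
      apply: set_ltI => //; first exact: schreier_FIN Bi.
      by move=> x y; exact: ltB.
Qed.

(** Cutting a chain down to [B] may empty some blocks, which [schreier_chain] tolerates; at a limit,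
    shrinking a set cannot lower its minimum. *)
Lemma schreier_subset a A B : schreier L a A -> B `<=` A -> schreier L a B.
Proof.
elim/(well_founded_ind omega1_lt_wf): a A B => a IH A B aA BA.
have [a0|[b ba]|la] := omega1_cases a.
- move: aA; rewrite (schreier0E L a0) => -[A0|[n _ An]].
    by left; apply/seteqP; split=> // x /BA; rewrite A0.
  have [[x Bx]|nB] := pselect (B !=set0).
    right; exists n => //; apply/seteqP; split=> y.
      by move=> ->; move: (BA _ Bx); rewrite -An /= => <-.
    by move=> /BA; rewrite -An.
  by left; apply/seteqP; split=> // x Bx; case: nB; exists x.
- have [ltba _] := ba.
  move: aA => /(schreier_succP _ ba) [bA|[d [dA chA]]].
    by apply/(schreier_succP _ ba); left; exact: IH bA BA.
  apply/(schreier_succP _ ba); right; exists d; split=> [x /BA /dA //|].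
  elim: (nat_of_Nstar d) A B BA chA {dA} => [|k IHk] A B BA /=.
    by move=> A0; apply/seteqP; split=> // x /BA; rewrite A0.
  move=> [C [D [AE bC chD CD]]].
  exists (B `&` C), (B `&` D); split.
  + by rewrite -setIUr -AE; apply/esym/setIidl.
  + by apply: IH bC _ => //; exact: subIsetr.
  + by apply: IHk chD; exact: subIsetr.
  + by move=> x y [_ Cx] [_ Dy]; exact: CD.
- have [B0|nB0] := pselect (B !=set0); last first.
    rewrite (_ : B = set0); first exact: schreier_set0.
    by apply/seteqP; split=> // x Bx; case: nB0; exists x.
  move: aA; rewrite (schreier_limE L la) => -[A0|[fA A0 [d dA LA]]].
    by case: B0 => x /BA; rewrite A0.
  right; split=> //; first exact: sub_finite_set fA.
  exists d; first by apply: le_setI => // x /BA; exact: le_set_le dA.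
  by apply: IH LA BA; have [_ /(_ d)] := fL la.
Qed.

(** Two blocks suffice, and [d = 2] lies below every element of N*. *)
Lemma schreier_insert a b (n : Nstar) A : is_succ a b -> schreier L a A ->
  (forall x, A x -> n < x) -> schreier L b (n |` A).
Proof.
move=> ab aA nA; apply/(schreier_succP _ ab); right.
exists (MkNstar (isT : 1 < 2)); split=> [x _|]; first exact: valP x.
exists [set n], A; split=> //; first exact: schreier_set1.
  exists A, set0; split=> //; by rewrite setU0.
by move=> x y ->; exact: nA.
Qed.

(* Each step adds at most one element, as a new first block. *)
Lemma schreier_iter_osucc m a A : schreier L a (A `&` [set x : Nstar | m <= x]) ->
  schreier L (iter m osucc a) A.
Proof.
elim: m a => [a|m IH a aA]; first by rewrite setIidl.
rewrite iterSr; apply: IH.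
have [[n [An nm]]|nm] := pselect (exists n : Nstar, A n /\ n = m :> nat).
  rewrite (_ : A `&` _ = n |` (A `&` [set x : Nstar | m < x])).
    by apply: schreier_insert (osuccP a) aA _ => x [_]; rewrite nm.
  apply/seteqP; split=> x /=.
    case=> Ax; rewrite leq_eqVlt => /orP[/eqP mx|mx]; last by right.
    by left; apply: val_inj; rewrite /= nm.
  by case=> [->|[Ax /ltnW]]; rewrite ?nm.
apply: (schreier_succ_sub (osuccP a)); rewrite (_ : A `&` _ = A `&` [set x : Nstar | m < x]) //.
apply/seteqP; split=> x /= [Ax]; last by move/ltnW.
rewrite leq_eqVlt => /orP[/eqP mx|//]; by case: nm; exists x.
Qed.

(** * Comparison of families with different indices *)

Lemma schreier_limI l (d : Nstar) A : is_limit l -> schreier L (L l d) A ->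
  (forall x, A x -> d <= x) -> schreier L l A.
Proof.
move=> ll LA dA; have [A0|nA0] := pselect (A !=set0).
  exact: (schreier_limit_le ll (schreier_FIN LA) A0 (le_setI A0 dA) LA).
rewrite (_ : A = set0); first exact: schreier_set0.
by apply/seteqP; split=> // x Ax; case: nA0; exists x.
Qed.

(** By induction on [b]. At a limit some [L b d] exceeds [a], and it suffices to start beyond both
    [d] and the threshold for [L b d]. *)
Lemma schreier_eventually a b : (a < b)%O -> exists m : nat,
  forall A, schreier L a A -> (forall x, A x -> m <= x) -> schreier L b A.
Proof.
elim/(well_founded_ind omega1_lt_wf): b => b IH ab.
have [b0|[c cb]|lb] := omega1_cases b.
- by have := b0 a; rewrite leNgt ab.
- have [ltcb _] := cb.
  move: (is_succ_le cb ab); rewrite le_eqVlt => /orP[/eqP ->|/(IH c ltcb)[m mP]].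
    by exists 0 => A cA _; exact: schreier_succ_sub cb cA.
  by exists m => A aA mA; apply: (schreier_succ_sub cb); exact: mP.
- have [_ Lb [_ Lmin]] := fL lb.
  have [d ad] : exists d, (a < L b d)%O.
    apply: contrapT => nd; have /Lmin : ubound (range (L b)) a.
      by move=> _ [d _ <-]; rewrite leNgt; apply/negP => ad; apply: nd; exists d.
    by rewrite leNgt ab.
  have [m mP] := IH _ (Lb d) ad.
  exists (maxn m d) => A aA mA; apply: (schreier_limI (d := d) lb).
    by apply: mP => // x /mA; rewrite geq_max => /andP[].
  by move=> x /mA; rewrite geq_max => /andP[].
Qed.

Lemma schreier_sub_iter_osucc k a : schreier L a `<=` schreier L (iter k osucc a).
Proof.
by elim: k => [//|k IH] A /IH; exact: schreier_succ_sub (osuccP _).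
Qed.

Lemma schreier_lt_sub a b : (a < b)%O ->
  exists k, schreier L a `<=` schreier L (iter k osucc b).
Proof.
move=> /schreier_eventually[m mP]; exists m => A aA.
apply: schreier_iter_osucc; apply: mP; last by move=> x [].
exact: schreier_subset aA (@subIsetl _ _ _).
Qed.

(** Inclusions cost finitely many successors, and a limit is closed under [osucc]. This is the
    directedness that [fundamental_sequence] asks for. *)
Lemma schreier_directed l (s : seq omega1) : is_limit l ->
  (forall b, b \in s -> (b < l)%O) -> exists2 c, (c < l)%O &
  forall b, b \in s -> (b < c)%O /\ schreier L b `<=` schreier L c.
Proof.
move=> ll; elim: s => [_|b s IH sl].
  apply: contrapT => nl; case: ll => + _; apply => c; rewrite leNgt.
  by apply/negP => cl; apply: nl; exists c.
have [|c cl cP] := IH; first by move=> x xs; apply: sl; rewrite inE xs orbT.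
have {}sl : (b < l)%O by apply: sl; rewrite inE eqxx.
suff [c' cl' [[ltb subb] [ltc subc]]] : exists2 c', (c' < l)%O &
    ((b < c')%O /\ schreier L b `<=` schreier L c') /\
    ((c < c')%O /\ schreier L c `<=` schreier L c').
  exists c' => // x; rewrite inE => /orP[/eqP -> //|/cP[xc subx]].
  by split; [exact: lt_trans xc ltc | exact: subset_trans subx subc].
wlog bc : b c sl cl {cP} / (b <= c)%O => [th|].
  have /orP[bc|cb] := le_total b c; first exact: th.
  by have [c' ? [? ?]] := th c b cl sl cb; exists c'.
have [k bk] : exists k, schreier L b `<=` schreier L (iter k osucc c).
  move: bc; rewrite le_eqVlt => /orP[/eqP ->|]; first by exists 0.
  exact: schreier_lt_sub.
(* One successor more than the inclusion needs makes the inequality strict even for [k = 0]. *)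
have ltc : (c < iter k.+1 osucc c)%O.
  exact: le_lt_trans (le_iter_osucc k c) (lt_osucc _).
exists (iter k.+1 osucc c); first exact: limit_iter_osucc.
split; split=> //; first exact: le_lt_trans ltc.
  by move=> A /bk; exact: schreier_succ_sub (osuccP _).
exact: schreier_sub_iter_osucc.
Qed.

End Schreier.

(** The recursion for the family of index [a] consults [L] only up to [a], so families can be used
    while [L] is still under construction. *)
Lemma eq_schreier L L' a : fundamental_system L ->
  (forall b, (b <= a)%O -> L b = L' b) -> schreier L a = schreier L' a.
Proof.
move=> fL; elim/(well_founded_ind omega1_lt_wf): a => a IH LL'.
have IH' b : (b < a)%O -> schreier L b = schreier L' b.
  by move=> ba; apply: IH => // c cb; apply: LL'; exact: le_trans cb (ltW ba).
have [a0|[b ba]|la] := omega1_cases a.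
- by rewrite !schreier0E.
- by rewrite !(schreierSE _ ba) IH'; case: ba.
- rewrite !(schreier_limE _ la) -(LL' a) //; congr (_ `|` _).
  have E d : schreier L (L a d) = schreier L' (L a d).
    by apply: IH'; have [_ /(_ d)] := fL _ la.
  by apply/seteqP; split=> A [fA A0 [d dA LA]]; split=> //; exists d => //;
    move: LA; rewrite E.
Qed.

(** * A fundamental system adapted to finite sets of ordinals *)

Definition fundamental_at (l : omega1) (t : Nstar -> omega1) : Prop :=
  is_limit l -> [/\ forall m n : Nstar, m < n -> (t m < t n)%O,
    forall n, (t n < l)%O & supremums (range t) l].

(** Each term is chosen by directedness above the previous term (for monotonicity), the next entry
    of an enumeration of the ordinals below [l] (for cofinality) and those entries of [w n] that lie
    below [l]. *)
Lemma fundamental_sequence (Q : omega1 -> omega1 -> Prop) l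
    (w : Nstar -> seq omega1) :
  (forall s : seq omega1, (forall b, b \in s -> (b < l)%O) ->
    exists2 c, (c < l)%O & forall b, b \in s -> (b < c)%O /\ Q b c) ->
  exists2 t, fundamental_at l t &
    forall n b, b \in w n -> (b < l)%O -> Q b (t n).
Proof.
move=> Qdir; have [e eP] := omega1_seg_enum l.
have /choice[D DP] : forall s : seq omega1, exists c,
    (forall b, b \in s -> (b < l)%O) ->
    (c < l)%O /\ forall b, b \in s -> (b < c)%O /\ Q b c.
  move=> s; have [/Qdir[c cl cP]|ns] := pselect (forall b, b \in s -> (b < l)%O).
    by exists c.
  by exists l => /ns.
(* The recursion runs over all of [nat]; nothing is prescribed at 0 and 1. *)
pose w' n := if insub n is Some k then w k else [::].
pose below (s : seq omega1) := [seq x <- s | (x < l)%O].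
pose u := fix u n :=
  D (below ((if n is m.+1 then [:: u m] else [::]) ++ e n :: w' n)).
have DbP s : (D (below s) < l)%O /\
    forall b, b \in s -> (b < l)%O -> (b < D (below s))%O /\ Q b (D (below s)).
  have [|Dl DQ] := DP (below s); first by move=> b; rewrite mem_filter => /andP[].
  by split=> // b bs bl; apply: DQ; rewrite mem_filter bl.
have ul n : (u n < l)%O by case: n => [|n]; exact: (DbP _).1.
have uS n : (u n < u n.+1)%O.
  have [_ /(_ (u n))[]//] := DbP ([:: u n] ++ e n.+1 :: w' n.+1).
  by rewrite inE eqxx.
have uP n b : b \in e n :: w' n -> (b < l)%O -> (b < u n)%O /\ Q b (u n).
  by move=> bw bl; case: n bw => [|n] bw; apply: (DbP _).2 => //=;
    rewrite inE bw orbT.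
have ult m n : m < n -> (u m < u n)%O.
  exact: (homo_ltn (fun y x z => @lt_trans _ _ y x z) uS).
exists (fun n : Nstar => u n) => [_|n b bw bl]; last first.
  by have [] := uP n b _ bl; rewrite // inE /w' valK bw orbT.
split=> //; first by move=> m n; exact: ult.
split=> [_ [n _ <-]|c cub]; first exact/ltW/ul.
rewrite leNgt; apply/negP => cl; have [i ei] := eP _ cl.
(* [u i] exceeds [e i], but [i] may be 0 or 1; the shift by two lands in N*. *)
have i2 : 1 < i.+2 by [].
have : (u (MkNstar i2) <= c)%O by apply: cub; exists (MkNstar i2).
rewrite leNgt => /negP; apply; apply: lt_trans (ult i i.+2 (ltnW (ltnSn _))).
by have [] := uP i c _ cl; rewrite // inE ei eqxx.
Qed.

Lemma ex_fundamental_system : exists L, fundamental_system L.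
Proof.
suff /choice[L LP] : forall l, exists t, fundamental_at l t.
  by exists L.
move=> l; have [ll|nl] := pselect (is_limit l); last by exists (fun=> l).
have [|t tP _] := @fundamental_sequence (fun _ _ => True) l (fun=> [::]);
  last by exists t.
elim=> [_|b s IH sl].
  apply: contrapT => nl; case: ll => + _; apply => c; rewrite leNgt.
  by apply/negP => cl; apply: nl; exists c.
have [|c cl cP] := IH; first by move=> x xs; apply: sl; rewrite inE xs orbT.
have {}sl : (b < l)%O by apply: sl; rewrite inE eqxx.
exists (osucc (Order.max b c)).
  by apply: limit_osucc => //; rewrite gt_max sl.
move=> x; rewrite inE => /orP[/eqP ->|/cP[xc _]]; split=> //.
  by apply: le_lt_trans (lt_osucc _); rewrite le_max lexx.
by apply: lt_trans xc (le_lt_trans _ (lt_osucc _)); rewrite le_max lexx orbT.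
Qed.

(* In the recursion step at [l], the part of [L] below [l] is completed by an
   arbitrary fundamental system so that the families make sense. *)
Lemma adapted_fundamental_system (w : omega1 -> Nstar -> seq omega1) :
  exists2 L, fundamental_system L & forall l (n : Nstar) b, is_limit l ->
    b \in w l n -> (b < l)%O -> schreier L b `<=` schreier L (L l n).
Proof.
have [L0 fL0] := ex_fundamental_system.
(* The recursion step must succeed for arbitrary earlier values, so [L b] is kept only where it
   really is fundamental. *)
pose patch (L : omega1 -> Nstar -> omega1) l b :=
  if (b < l)%O && `[< fundamental_at b (L b) >] then L b else L0 b.
have fpatch L l : fundamental_system (patch L l).
  move=> b lb; rewrite /patch; case: andP => [[_ /asboolP fb]|_]; first exact: fb.
  exact: fL0.
pose R l L t := fundamental_at l t /\ forall (n : Nstar) b, is_limit l ->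
  b \in w l n -> (b < l)%O ->
  schreier (patch L l) b `<=` schreier (patch L l) (t n).
have [|||L LR] := @omega1_rec _ R.
- by have [c _] := omega1_seq_bounded (of_void omega1); split=> _; exact: c.
- move=> l L; have [ll|nl] := pselect (is_limit l); last first.
    by exists (fun=> l); split=> [/nl|n b /nl].
  have [s sl|t ft tP] := @fundamental_sequence
      (fun b c => schreier (patch L l) b `<=` schreier (patch L l) c) l (w l).
    exact: schreier_directed.
  by exists t; split=> // n b _; exact: tP.
- move=> l L L' t LL'; rewrite /R.
  suff -> : patch L l = patch L' l by [].
  by apply/funext => b; rewrite /patch; case: ltP => //= bl; rewrite LL'.
have fL : fundamental_system L by move=> l; have [] := LR l.
exists L => // l n b ll bw bl.
have patchE c : (c < l)%O -> schreier L c = schreier (patch L l) c.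
  move=> cl; apply: eq_schreier => // b' b'c; rewrite /patch asboolT; last exact: fL.
  by rewrite (le_lt_trans b'c cl).
have [fl /(_ n b ll bw bl)] := LR l; rewrite !patchE //.
by have [_ /(_ n)] := fl ll.
Qed.

(** Take a limit [l] above [l0] and all [b n]. If [b n] is captured by [w l n], the limit clause
    applies with [d = n], the minimum of [A]. The finitely many other [n] share a threshold [M],
    paid for by [M] successors. *)
Lemma schreier_diagonal (w : omega1 -> Nstar -> seq omega1) L : fundamental_system L ->
  (forall l (n : Nstar) b, is_limit l ->
    b \in w l n -> (b < l)%O -> schreier L b `<=` schreier L (L l n)) ->
  (forall b : Nstar -> omega1, exists l0, forall l, (l0 < l)%O ->
    finite_set [set n : Nstar | b n \notin w l n]) ->
  forall b : Nstar -> omega1, exists a, forall n A,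
    is_min A n -> schreier L (b n) A -> schreier L a A.
Proof.
move=> fL wL wb b; have [l0 l0P] := wb b; have [c bc] := omega1_seq_bounded b.
have [l ll] := limit_above (Order.max l0 c); rewrite gt_max => /andP[ll0 cl].
have bl n : (b n < l)%O by exact: lt_trans (bc n) cl.
have /choice[m mP] : forall n, exists m : nat, forall A, schreier L (b n) A ->
    (forall x, A x -> m <= x) -> schreier L l A.
  by move=> n; exact: schreier_eventually.
have [M mM] := finite_set_bounded m (l0P l ll0).
exists (iter M osucc l) => n A [An nA] bA; apply: schreier_iter_osucc => //.
have [nw|/negP/negPn nw] := pselect (b n \notin w l n).
  apply: (mP n); first exact: schreier_subset bA (@subIsetl _ _ _).
  by move=> x [_ /=]; apply: leq_trans; exact: mM.
apply: (schreier_subset fL _ (@subIsetl _ A _)).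
by apply: (schreier_limI (d := n) ll) => //; exact: wL bA.
Qed.

(** * Compact families *)

Lemma nbhs_coord (p : prod_topology (fun _ : Nstar => bool)) (x : Nstar) :
  nbhs p [set q | q x = p x].
Proof. exact: (@proj_continuous _ (fun=> bool) x p _ (discrete_set1 (p x))). Qed.

Lemma charfun_eq A B : (forall x, charfun A x = charfun B x) -> A = B.
Proof.
move=> AB; apply/seteqP; split=> x xAB; apply/set_mem.
  by have := AB x; rewrite /charfun => <-; exact: mem_set.
by have := AB x; rewrite /charfun => ->; exact: mem_set.
Qed.

(** A cluster point of the sequence agrees with [X] at every coordinate, because fixing one
    coordinate is an open condition. *)
Lemma compact_family_limit K (A : nat -> set Nstar) X : compact_family K ->
  (forall i, K (A i)) ->
  (forall x, exists N, forall i, N <= i -> (A i x <-> X x)) -> K X.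
Proof.
move=> cK KA AX.
have [|_ [[B KB <-] clB]] := cK ((fun i => charfun (A i)) @ \oo) _.
  by exists 0 => // i _ /=; exists (A i).
suff -> : X = B by [].
apply: charfun_eq => x; have [N NP] := AX x.
have [|_ [[i /= Ni <-] <-]] := clB [set charfun (A i) | i in [set i | N <= i]] _ _
  (nbhs_coord (charfun B) x).
  by exists N => // i /= Ni; exists i.
rewrite /charfun; apply/idP/idP => /set_mem /(NP _ Ni) h; exact/mem_set.
Qed.

Lemma hausdorff_Cantor : hausdorff_space (prod_topology (fun _ : Nstar => bool)).
Proof. by apply: hausdorff_product => _; exact: discrete_hausdorff. Qed.

Lemma compact_Cantor : compact [set: prod_topology (fun _ : Nstar => bool)].
Proof.
have := @tychonoff _ (fun _ : Nstar => bool) (fun=> setT) (fun=> bool_compact).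
by congr compact; apply/seteqP.
Qed.

(** [K] is closed: a point of its closure is the empty set, or contains some [x] and is then in the
    closure of the finite, hence closed, set of members containing [x]. *)
Lemma compact_family_point_finite (K : set (set Nstar)) : K set0 ->
  (forall x, finite_set [set A | K A /\ A x]) -> compact_family K.
Proof.
move=> K0 Kfin; apply: subclosed_compact compact_Cantor _ => // p clp.
have [[x px]|np] := pselect (exists x, p x); last first.
  exists set0 => //; apply/funext => x; rewrite /charfun in_set0.
  by apply/esym/negP => px; apply: np; exists x.
have : closure (charfun @` [set A | K A /\ A x]) p.
  move=> U Up; have [] := clp (U `&` [set q | q x = p x]).
    exact: filterI Up (nbhs_coord p x).
  move=> _ [[A KA <-] [UA /= Ax]]; exists (charfun A); split=> //.
  by exists A => //; split=> //; move: Ax; rewrite px => /set_mem.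
rewrite -(closure_id _).1 => [[A [KA _] <-]|]; first by exists A.
apply: compact_closed hausdorff_Cantor _.
exact/finite_compact/finite_image.
Qed.

(** * Interval families and the functions [schreier_max L a] *)

Definition Nstar_max (m n : Nstar) : Nstar := if m <= n then n else m.

Lemma Nstar_maxl (m n : Nstar) : m <= Nstar_max m n.
Proof. by rewrite /Nstar_max; case: ifP. Qed.

Lemma Nstar_maxr (m n : Nstar) : n <= Nstar_max m n.
Proof. by rewrite /Nstar_max; case: ifP => // /negbT; rewrite -ltnNge => /ltnW. Qed.

(** The empty set is the limit of these intervals; the maximum with [n] keeps them non-empty. *)
Definition graph_family (g : Nstar -> Nstar) : set (set Nstar) :=
  [set set0] `|` range (fun n => interval n (Nstar_max n (g n))).

Lemma graph_family_interval g : interval_family (graph_family g).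
Proof.
split=> [A [->|[n _ <-]]|A [->|[n _ <-] _]].
- exact: finite_set0.
- by apply: sub_finite_set (finite_Nstar_le (Nstar_max n (g n))) => x /andP[].
- by case.
- by exists n, (Nstar_max n (g n)); split=> //; exact: Nstar_maxl.
Qed.

Lemma compact_graph_family g : compact_family (graph_family g).
Proof.
apply: compact_family_point_finite => [|x]; first by left.
apply: sub_finite_set (finite_image
  (fun n => interval n (Nstar_max n (g n))) (finite_Nstar_le x)).
by move=> _ [[->//|[n _ <-]] /andP[nx _]]; exists n.
Qed.

Lemma interval_injl (n m k j : Nstar) :
  n <= k -> m <= j -> interval n k = interval m j -> n = m.
Proof.
move=> /interval_min nk /interval_min mj e; rewrite e in nk.
exact: is_min_unique nk mj.
Qed.

(** The hypothesis is applied to [graph_family g]. Intervals with different left endpoints differ,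
    so finitely many exceptional intervals mean finitely many exceptional [n]. *)
Lemma schreier_max_cofinal L : fundamental_system L ->
  (forall K, interval_family K -> compact_family K ->
    exists a, finite_set (K `\` schreier L a)) ->
  le_star_cofinal (range (schreier_max L)).
Proof.
move=> fL LK g.
have [a afin] := LK _ (graph_family_interval g) (@compact_graph_family g).
exists (schreier_max L a); first by exists a.
pose I n := interval n (Nstar_max n (g n)).
apply: (@sub_finite_set _ _ (I @^-1` (graph_family g `\` schreier L a))).
  move=> n /= ng; split; first by right; exists n.
  move=> aI; apply: ng; have [_ smax] := schreier_maxP a n fL.
  by apply: leq_trans (Nstar_maxr n _) (smax _ _); split=> //; exact: Nstar_maxl.
apply: finite_preimage afin => m n _ _; apply: interval_injl; exact: Nstar_maxl.
Qed.

Lemma schreier_max_interval L a (n k : Nstar) : fundamental_system L ->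
  n <= k -> k <= schreier_max L a n -> schreier L a (interval n k).
Proof.
move=> fL nk ks; have [[_ aI] _] := schreier_maxP a n fL.
apply: (schreier_subset fL aI) => x /andP[nx xk].
by rewrite /interval /= nx (leq_trans xk).
Qed.

(** Otherwise intervals starting at [n] would converge to an infinite final segment, which
    compactness would put into [K]. *)
Lemma compact_interval_bounded K (n : Nstar) : interval_family K -> compact_family K ->
  exists b : nat, forall k : Nstar, n <= k -> K (interval n k) -> k <= b.
Proof.
move=> [KF _] cK; apply: contrapT => nb.
have /choice[k kP] : forall b : nat, exists k : Nstar,
    [/\ n <= k, K (interval n k) & b < k].
  move=> b; apply: contrapT => nk; apply: nb; exists b => k nk' Kk.
  by rewrite leqNgt; apply/negP => bk; apply: nk; exists k.
have /KF : K [set x : Nstar | n <= x].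
  apply: (compact_family_limit (A := fun i => interval n (k i)) cK).
    by move=> i; case: (kP i).
  move=> x; exists x => i xi; have [_ _ ik] := kP i; rewrite /interval /=.
  by split=> [/andP[]//|->]; exact: ltnW (leq_ltn_trans xi ik).
move=> /(finite_set_bounded nat_of_Nstar)[M MP].
have M1 : 1 < maxn n M.+1 by rewrite leq_max (valP n).
have := MP (MkNstar M1); rewrite /= leq_maxl => /(_ isT).
by rewrite geq_max ltnn andbF.
Qed.

(** Let [g n] bound the right endpoints of the intervals in [K] starting at [n]. Where
    [schreier_max L a] dominates [g], heredity puts them into the family; each of the finitely many
    other [n] contributes finitely many intervals. *)
Lemma compact_interval_almost_schreier L : fundamental_system L ->
  le_star_cofinal (range (schreier_max L)) ->
  forall K, interval_family K -> compact_family K ->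
    exists a, finite_set (K `\` schreier L a).
Proof.
move=> fL cof K iK cK.
have /choice[g gP] : forall n : Nstar, exists b : Nstar, forall k : Nstar, n <= k ->
    K (interval n k) -> k <= b.
  move=> n; have [b bP] := compact_interval_bounded n iK cK.
  have b1 : 1 < b.+2 by [].
  by exists (MkNstar b1) => k nk /(bP _ nk) kb; exact: leqW (leqW kb).
have [_ [a _ <-] ga] := cof g; exists a.
pose bad := [set n | ~ g n <= schreier_max L a n].
apply: (@sub_finite_set _ _ (\bigcup_(n in bad) (interval n @` [set k : Nstar | k <= g n]))).
  move=> A [KA naA].
  have [|n [k [nk AE]]] := iK.2 _ KA.
    apply: contrapT => A0; apply: naA; rewrite (_ : A = set0); first exact: schreier_set0.
    by apply/seteqP; split=> // x Ax; case: A0; exists x.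
  rewrite AE in KA naA *; have kg := gP _ _ nk KA.
  exists n => [gs|]; last by exists k.
  by apply: naA; apply: schreier_max_interval => //; exact: leq_trans kg gs.
by apply: bigcup_finite => // n _; exact/finite_image/finite_Nstar_le.
Qed.

(* If no [a] works, then no [a] works for the tails of those members of [K] that
   start with [n], for some [n]; iterating builds an infinite set all of whose
   initial segments are initial segments of members of [K]. *)
Lemma compact_sub_schreier L K : fundamental_system L ->
  (forall b : Nstar -> omega1, exists a, forall n A,
    is_min A n -> schreier L (b n) A -> schreier L a A) ->
  K `<=` FIN -> compact_family K -> exists a, K `<=` schreier L a.
Proof.
move=> fL diag KF cK; apply: contrapT => nK.
pose head m (A : set Nstar) := A `&` [set x : Nstar | x <= m].
pose tail m (A : set Nstar) := A `&` [set x : Nstar | m < x].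
pose bad (s : set Nstar * nat) := forall a, exists A,
  [/\ K A, head s.2 A = s.1 & ~ schreier L a (tail s.2 A)].
(* Conditioning on [bad s] makes the relation total, as dependent choice requires. *)
pose R s s' := bad s -> [/\ bad s', s.2 < s'.2 &
  s'.1 = s.1 `|` [set x : Nstar | x = s'.2 :> nat]].
have step s : exists s', R s s'.
  have [bs|nbs] := pselect (bad s); last by exists s.
  apply: contrapT => ns.
  have /choice[c cP] : forall n : Nstar, exists a, s.2 < n -> forall A, K A ->
      head n A = n |` s.1 -> schreier L a (tail n A).
    move=> n; apply: contrapT => na; apply: ns; exists (n |` s.1, nat_of_Nstar n) => _.
    have [sn|ns] := ltnP s.2 n; last first.
      exfalso; apply: na; have [a _] := omega1_seq_bounded (of_void omega1); exists a.
      by rewrite ltnNge ns.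
    split=> //=.
      move=> a; apply: contrapT => nA; apply: na; exists a => _ A KA hA.
      by apply: contrapT => tA; apply: nA; exists A.
    rewrite setUC; congr (_ `|` _); apply/seteqP; split=> x /=; first by move->.
    exact: val_inj.
  (* If no extension is bad, a tail starting with [n] is [n] followed by a member of the family of
     index [c n]; prepending [n] costs one successor. *)
  have [a aP] := diag (fun n => osucc (c n)).
  have [A [KA hA]] := bs a; apply.
  have [/set_Nstar_min[n nA]|nA] := pselect (tail s.2 A !=set0); last first.
    rewrite (_ : tail _ _ = set0); first exact: schreier_set0.
    by apply/seteqP; split=> // x Ax; case: nA; exists x.
  apply: (aP n) => //; have [[An sn] nmin] := nA.
  have -> : tail s.2 A = n |` tail n A.
    apply/seteqP; split=> x /=.
      move=> Ax; have := nmin _ Ax; rewrite leq_eqVlt => /orP[/eqP/val_inj ->|nx].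
        by left.
      by right; split=> //; case: Ax.
    by case=> [->|[Ax nx]]; split=> //; exact: ltn_trans sn nx.
  apply: (schreier_insert fL (osuccP _)); last by move=> x [].
  apply: cP => //; rewrite -hA; apply/seteqP; split=> x /=.
    move=> [Ax xn]; have [xs|sx] := leqP x s.2; first by right.
    by left; apply/val_inj/eqP; rewrite eqn_leq xn nmin.
  by case=> [->|[Ax /= xs]]; split=> //=; exact: leq_trans xs (ltnW sn).
have [u [u0 uS]] := dependent_choice (fun s => cid (step s)) (set0, 0).
have ubad i : bad (u i).
  elim: i => [|i /uS[]//]; rewrite u0 => a; apply: contrapT => na; apply: nK.
  exists a => A KA; apply: contrapT => naA; apply: na; exists A; split=> //=.
    by apply/seteqP; split=> // x [_ /=]; rewrite leqn0 => /eqP x0; have := valP x; rewrite /= x0.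
  rewrite (_ : tail 0 A = A) //; apply/seteqP; split=> x; first by case.
  by move=> Ax; split=> //; exact: ltnW (valP x).
have ule i : i <= (u i).2.
  elim: i => // i IH; have [_ + _] := uS i (ubad i); exact: leq_ltn_trans.
(* Membership of [x] is settled at stage [x], since stage [i.+1] only adds an element above [i]. *)
have uE i (x : Nstar) : x <= i -> (u i).1 x <-> (u x).1 x.
  move=> /subnKC <-; elim: (i - x) => [|k IH]; first by rewrite addn0.
  rewrite addnS; have [_ lt ->] := uS (x + k) (ubad _); rewrite -IH.
  split=> [[//|/= xu]|]; last by left.
  by have := leq_ltn_trans (ule (x + k)) lt; rewrite -xu ltnNge leq_addr.
have /choice[A AP] : forall i, exists A, K A /\ head (u i).2 A = (u i).1.
  move=> i; have [c _] := omega1_seq_bounded (of_void omega1).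
  by have [A [? ? _]] := ubad i c; exists A.
have /KF : K [set x : Nstar | (u x).1 x].
  apply: (compact_family_limit (A := A) cK) => [i|x]; first by case: (AP i).
  exists x => i xi /=; rewrite -(uE i) // -(AP i).2 /head /=.
  by split=> [|[]//]; split=> //; exact: leq_trans xi (ule i).
move=> /(finite_set_bounded nat_of_Nstar)[M MP].
have [_ ltM uM] := uS M.+1 (ubad _).
(* The element added at stage [M.+2] belongs to the limit set and exceeds its supposed bound [M]. *)
have u1 : 1 < (u M.+2).2 by exact: leq_trans (ule _).
have /MP /= : [set x : Nstar | (u x).1 x] (MkNstar u1).
  have mono i j (x : Nstar) : i <= j -> (u i).1 x -> (u j).1 x.
    move=> /subnKC <-; elim: (j - i) => [|k IH ux]; first by rewrite addn0.
    by rewrite addnS; have [_ _ ->] := uS (i + k) (ubad _); left; exact: IH.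
  by apply: (mono M.+2); [exact: ule | rewrite uM; right].
by rewrite leqNgt (leq_trans _ (ule _)).
Qed.

(** * The dominating number *)

(** Diagonalisation: [g] exceeds the [i]-th function of an enumeration at every [n >= i]. *)
Lemma le_star_cofinal_uncountable F : le_star_cofinal F -> ~ countable F.
Proof.
move=> cofF /pfcard_geP[F0|[/= h]].
  by have [f] := cofF id; rewrite F0.
pose g (n : Nstar) : Nstar :=
  insubd n (\max_(i < n.+1) (h i n : nat)).+1.
have gP i (n : Nstar) : i <= n -> h i n < g n.
  move=> ni; have hle : h i n <= \max_(i < n.+1) (h i n : nat).
    exact: (leq_bigmax (Ordinal (ni : i < n.+1))).
  by rewrite /g val_insubd ltnS (leq_trans _ hle) // ltnW // (valP (h i n)).
have [f Ff gf] := cofF g; have [i _ fi] := 'surj_h Ff.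
have [M MP] := finite_set_bounded nat_of_Nstar gf.
have m1 : 1 < (maxn i M).+2 by [].
suff /MP /= : [set n | ~ g n <= f n] (MkNstar m1).
  by rewrite leqNgt ltnS leqW // leq_maxr.
apply/negP; rewrite -ltnNge -fi; apply: gP.
exact: leqW (leqW (leq_maxl _ _)).
Qed.

(** Transfinite recursion picks elements of [F] distinct from the countably many picked before. *)
Lemma omega1_card_le (T : Type) (F : set T) : ~ countable F -> [set: omega1] #<= F.
Proof.
move=> nF.
have notsub (C : set T) : countable C -> exists t, F t /\ ~ C t.
  move=> cC; apply: contrapT => nt; apply: nF.
  apply: sub_countable cC; apply: subset_card_le => t Ft.
  by apply: contrapT => nC; apply: nt; exists t.
pose R a (f : omega1 -> T) t := F t /\ forall b, (b < a)%O -> f b <> t.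
have [|||f fR] := @omega1_rec T R.
- by have [t _] := notsub _ (countable0 T); exact: inhabits t.
- move=> a f; have [|t [Ft nt]] := notsub (f @` [set b | (b < a)%O]).
    exact: sub_countable (card_image_le _ _) (countable_omega1_seg a).
  by exists t; split=> // b ba e; apply: nt; exists b.
- by move=> a f g t fg [Ft ft]; split=> // b ba; rewrite -fg //; exact: ft.
have finj : {in [set: omega1] &, injective f}.
  move=> a b _ _ fab; have [ab|ba|//] := ltgtP a b.
    by have [_ /(_ a ab)] := fR b.
  by have [_ /(_ b ba)] := fR a; rewrite fab.
rewrite -(card_le_eql (inj_card_eq finj)); apply: subset_card_le.
by move=> _ [a _ <-]; case: (fR a).
Qed.

Lemma dominating_omega1 (f : omega1 -> Nstar -> Nstar) :
  le_star_cofinal (range f) -> is_dominating_number [set: omega1].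
Proof.
move=> cof; have le F : le_star_cofinal F -> [set: omega1] #<= F.
  by move=> /le_star_cofinal_uncountable; exact: omega1_card_le.
split=> //; exists (range f) => //.
by apply: Cantor_Bernstein; [exact: card_image_le | exact: le].
Qed.

(* One [l] treats all pairs (c, a) of smaller ordinals at once: [c] bounds the
   sequence [b], and [f a] almost dominates the indices of the values of [b] in
   the enumeration of [c]. *)
Lemma dominating_capture : is_dominating_number [set: omega1] ->
  exists w : omega1 -> Nstar -> seq omega1, forall b : Nstar -> omega1,
    exists l0, forall l, (l0 < l)%O -> finite_set [set n : Nstar | b n \notin w l n].
Proof.
move=> [[F cofF]]; rewrite card_eq_le => /andP[/pfcard_geP[F0|[/= f]] _] _.
  by have [g] := cofF id; rewrite F0.
have /choice[e eP] := omega1_seg_enum.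
(* The first [n] entries of [e l] are used twice: as candidates for [c], whose enumeration is then
   read, and inside the maximum as candidates for [a], bounding how far it is read. *)
exists (fun l (n : Nstar) => [seq e (e l i) j | i <- iota 0 n,
  j <- iota 0 (\max_(i < n) (f (e l i) n : nat)).+1]) => b.
have [c bc] := omega1_seq_bounded b.
have /choice[g gP] : forall n, exists i, e c i = b n by move=> n; exact: eP.
have [h Fh gh] := cofF (fun n => MkNstar (isT : 1 < (g n).+2)).
have [a _ ah] := 'surj_f Fh; rewrite -ah in gh.
exists (Order.max c a) => l; rewrite gt_max => /andP[/eP[i ci] /eP[j aj]].
apply: (@sub_finite_set _ _ ([set n | ~ (g n).+2 <= f a n] `|`
  [set n : Nstar | n <= maxn i j])); last first.
  by rewrite finite_setU; split=> //; exact: finite_Nstar_le.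
move=> n nw; have [|] := leqP n (maxn i j); first by right.
rewrite gtn_max => /andP[ni nj]; left => gf; move/negP: nw; apply.
apply/allpairsP; exists (i, g n).
rewrite !mem_iota add0n ltnS; split=> //; last by rewrite /= ci gP.
apply: leq_trans (leq_bigmax (Ordinal nj)); rewrite /= aj.
exact: leq_trans (ltnW (ltnW (leqnn _))) gf.
Qed.

(** * The cycle of implications *)

Theorem theorem2 :
  [<-> is_dominating_number [set: omega1];
       exists2 L, fundamental_system L &
         forall K, K `<=` FIN -> compact_family K ->
           exists a, K `<=` schreier L a;
       exists2 L, fundamental_system L &
         le_star_cofinal (range (schreier_max L));
       exists2 L, fundamental_system L &
         forall K, interval_family K -> compact_family K ->
           exists a, finite_set (K `\` schreier L a)].
Proof.
tfae.
- move=> /dominating_capture[w wP]; have [L fL Lw] := adapted_fundamental_system w.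
  exists L => // K KF cK; apply: compact_sub_schreier => //.
  exact: schreier_diagonal fL Lw wP.
- move=> [L fL LK]; exists L => //; apply: schreier_max_cofinal => // K [KF _] cK.
  have [a Ka] := LK K KF cK; exists a.
  rewrite (_ : K `\` _ = set0); first exact: finite_set0.
  by apply/seteqP; split=> // A [/Ka].
- by move=> [L fL cof]; exists L => //; exact: compact_interval_almost_schreier.
- move=> [L fL LK]; apply: dominating_omega1; exact: schreier_max_cofinal LK.
Qed.
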